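(* Let $(\Gamma,P)$, with $\Gamma=(N,K,C,T)$ and $P=\{P_1,\dots,P_A\}$, be a generalized highway problem with a coalitional structure, $(N,c,P)$ its associated game with a coalitional structure, and $M=\{1,\dots,A\}$ the set of a priori unions. Let $a^*$ be the alliance that results from merging the unions $\{1,\dots,a\}\subseteq M$ (with $2\le a\le A$), that is $P_{a^*}=\bigcup_{\alpha=1}^a P_\alpha$, and let $P^*=\{P_{a^*},P_{a+1},\dots,P_A\}$. Then $$\Psi_{a^*}(N,c,P^* )\le\sum_{\alpha\in\{1,\dots,a\}}\Psi_\alpha(N,c,P),$$ where the inequality is strict if and only if there exists at least one section used by at least two unions from the alliance and by at least one other union that is not part of the alliance.
   Context: A generalized highway problem is a 4-tuple $\Gamma=(N,K,C,T)$ where $N$ is a finite set of agents, $K$ is a finite nonempty ordered set of sections, $C:K\to\mathbb{R}_+$ gives the cost of each section, and $T:N\to 2^K\setminus\{\emptyset\}$ gives the set of sections used by each agent, with $\bigcup_{i\in N}T(i)=K$. For $S\subseteq N$ put $T(S)=\bigcup_{i\in S}T(i)$, and for $K'\subseteq K$ put $C(K')=\sum_{t\in K'}C(t)$. The associated cost game is $(N,c)$ with $c(S)=C(T(S))$ for all $S\subseteq N$. If $P=\{P_1,\dots,P_A\}$ is a partition of $N$ (into a priori unions), $(\Gamma,P)$ is a generalized highway problem with a coalitional structure and $(N,c,P)$ its associated game with a coalitional structure. A union $P_b$ uses section $t$ if $t\in T(P_b)$; the unions from the alliance are $P_1,\dots,P_a$, and those not part of it are $P_{a+1},\dots,P_A$.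 For a cost game $(N,c,P)$ with a coalitional structure and $M=\{1,\dots,A\}$, the Owen value is, for $i\in P_a$, $$\Psi_i(N,c,P)=\sum_{H\subseteq M\setminus\{a\}}\ \sum_{S\subseteq P_a\setminus\{i\}}\frac{1}{|P_a|\cdot A}\cdot\frac{1}{\binom{A-1}{|H|}\binom{|P_a|-1}{|S|}}\bigl(c(R\cup S\cup\{i\})-c(R\cup S)\bigr),\qquad R=\bigcup_{b\in H}P_b .$$ The total payment of a union $b$ is $\Psi_b(N,c,P)=\sum_{i\in P_b}\Psi_i(N,c,P)$ (and likewise for $P^*$).
   Formalization: The characterization of strict inequality is stated only when every section has strictly positive cost, since with zero-cost sections it can fail (all costs zero gives equality); the inequality itself is stated for all nonnegative costs. *)

(* Defs.v *)
From mathcomp Require Export all_boot all_order all_algebra.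
From mathcomp Require Export reals.

Set Implicit Arguments.
Unset Strict Implicit.
Unset Printing Implicit Defensive.

Import Order.TTheory GRing.Theory Num.Theory.

Local Open Scope ring_scope.

(* [finTBOrderType] is the type of nonempty totally ordered finite types. *)
Record highway (R : realType) (N : finType) (d : Order.disp_t)
    (K : finTBOrderType d) := Highway {
  section_cost : K -> R;
  sections : N -> {set K};
  section_cost_ge0 : forall t, 0 <= section_cost t;
  sections_neq0 : forall i, sections i != set0;
  sections_cover : \bigcup_(i : N) sections i = [set: K]
}.

Definition coalition_sections (R : realType) (N : finType) (d : Order.disp_t)
    (K : finTBOrderType d) (G : highway R N K) (S : {set N}) : {set K} :=
  \bigcup_(i in S) sections G i.

Definition highway_game (R : realType) (N : finType) (d : Order.disp_t)
    (K : finTBOrderType d) (G : highway R N K) (S : {set N}) : R :=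
  \sum_(t in coalition_sections G S) section_cost G t.

(* The Owen value. The coalitional structure is given as the set [P] of its
   unions, so that a set of union indices is here a subset [H] of [P] and the
   union R of its members is [cover H]; [pblock P i] is the union of [i]. *)
Definition owen (R : realType) (N : finType) (c : {set N} -> R)
    (P : {set {set N}}) (i : N) : R :=
  let B := pblock P i in
  \sum_(H : {set {set N}} | H \subset P :\ B)
    \sum_(S : {set N} | S \subset B :\ i)
      (#|B|%:R * #|P|%:R)^-1
      * ('C(#|P|.-1, #|H|)%:R * 'C(#|B|.-1, #|S|)%:R)^-1
      * (c (cover H :|: S :|: [set i]) - c (cover H :|: S)).

Definition union_payment (R : realType) (N : finType) (c : {set N} -> R)
    (P : {set {set N}}) (B : {set N}) : R :=
  \sum_(i in B) owen c P i.

Definition unions (N : finType) (A : nat) (P : 'I_A -> {set N}) :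
    {set {set N}} :=
  [set P b | b : 'I_A].

(* Indices start at 0: the members of the alliance are the [b < a]. *)
Definition alliance (N : finType) (A : nat) (P : 'I_A -> {set N}) (a : nat) :
    {set N} :=
  \bigcup_(b : 'I_A | (b < a)%N) P b.

Definition merged_unions (N : finType) (A : nat) (P : 'I_A -> {set N})
    (a : nat) : {set {set N}} :=
  alliance P a |: [set P b | b : 'I_A & (a <= b)%N].

Definition union_uses (R : realType) (N : finType) (d : Order.disp_t)
    (K : finTBOrderType d) (G : highway R N K) (B : {set N}) (t : K) : bool :=
  t \in coalition_sections G B.

(* Main.v *)
(* By efficiency of the Shapley value inside a union, the total payment of a
   union is its Shapley value in the game between unions. That game is a sum of
   one game per section, in which the cost of [t] is split evenly among the
   unions that use [t]. If [k] members of the alliance and [m] other unions use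
   [t], the alliance pays [k / (k + m)] of its cost before merging and
   [1 / (m + 1)] after (if [k > 0]). *)
Require Import Defs.
From mathcomp Require Import ring.

Set Implicit Arguments.
Unset Strict Implicit.
Unset Printing Implicit Defensive.

Import Order.TTheory GRing.Theory Num.Theory.

Local Open Scope ring_scope.

(** * Shapley weights and efficiency *)

(** For [s < b] this is [s! (b - 1 - s)! / b!], the Shapley weight of a coalition of size [s] among
    [b] players; the coefficient in [owen] is a product of two such weights. *)
Definition shapley_weight (F : numFieldType) (b s : nat) : F :=
  b%:R^-1 * ('C(b.-1, s))%:R^-1.

(** Any of the [u] members of a coalition may be the last to join it, whence the factor [u]; the
    identity behind it is [b 'C(b - 1, u - 1) = u 'C(b, u)]. *)
Lemma shapley_weight_pred (F : numFieldType) (b u : nat) :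
  (0 < u <= b)%N -> u%:R * shapley_weight F b u.-1 = 'C(b, u)%:R^-1.
Proof.
case: u b => [|u] [|b] //= ub; rewrite /shapley_weight /=.
have C0 : 'C(b, u)%:R != 0 :> F by rewrite pnatr_eq0 -lt0n bin_gt0.
have D0 : 'C(b.+1, u.+1)%:R != 0 :> F by rewrite pnatr_eq0 -lt0n bin_gt0.
have b0 : b.+1%:R != 0 :> F by rewrite pnatr_eq0.
apply: (mulfI b0); apply: (mulfI C0); apply: (mulfI D0).
have E : b.+1%:R * 'C(b, u)%:R = u.+1%:R * 'C(b.+1, u.+1)%:R :> F.
  by rewrite -!natrM mul_bin_diag.
transitivity (u.+1%:R * 'C(b.+1, u.+1)%:R : F).
  by field; rewrite C0 addrC natr1 b0.
by rewrite -E; field.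
Qed.

(** Here the factor counts the players who may still join a coalition of size [u]. *)
Lemma shapley_weight_compl (F : numFieldType) (b u : nat) :
  (u < b)%N -> (b - u)%:R * shapley_weight F b u = 'C(b, u)%:R^-1.
Proof.
case: b => // b ub; rewrite /shapley_weight /=.
have C0 : 'C(b, u)%:R != 0 :> F by rewrite pnatr_eq0 -lt0n bin_gt0.
have D0 : 'C(b.+1, u)%:R != 0 :> F by rewrite pnatr_eq0 -lt0n bin_gt0 ltnW.
have b0 : b.+1%:R != 0 :> F by rewrite pnatr_eq0.
apply: (mulfI b0); apply: (mulfI C0); apply: (mulfI D0).
have E : b.+1%:R * 'C(b, u)%:R = (b.+1 - u)%:R * 'C(b.+1, u)%:R :> F.
  by rewrite -!natrM mul_bin_down.
transitivity ((b.+1 - u)%:R * 'C(b.+1, u)%:R : F).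
  by field; rewrite C0 addrC natr1 b0.
by rewrite -E; field.
Qed.

(* Both halves of the sum collect, for each coalition [U] of [B], the value
   [v U / 'C(#|B|, #|U|)]; they miss only [set0] and [B] respectively. *)
Lemma shapley_efficiency (F : numFieldType) (T : finType) (B : {set T})
    (v : {set T} -> F) :
  \sum_(i in B) \sum_(S : {set T} | S \subset B :\ i)
    shapley_weight F #|B| #|S| * (v (i |: S) - v S) = v B - v set0.
Proof.
pose g (U : {set T}) : F := 'C(#|B|, #|U|)%:R^-1 * v U.
have gB : g B = v B by rewrite /g binn invr1 mul1r.
have g0 : g set0 = v set0 by rewrite /g cards0 bin0 invr1 mul1r.
pose w := shapley_weight F #|B|.
transitivity (\sum_(i in B) \sum_(S : {set T} | S \subset B :\ i)
                w #|S| * v (i |: S)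
  - \sum_(i in B) \sum_(S : {set T} | S \subset B :\ i) w #|S| * v S).
  rewrite -sumrB; apply: eq_bigr => i _; rewrite -sumrB.
  by apply: eq_bigr => S _; rewrite mulrBr.
have -> : \sum_(i in B) \sum_(S : {set T} | S \subset B :\ i)
    w #|S| * v (i |: S) = \sum_(U : {set T} | U \subset B) g U - v set0.
  transitivity (\sum_(i in B) \sum_(U : {set T} | (U \subset B) && (i \in U))
                  w #|U|.-1 * v U).
    apply: eq_bigr => i iB.
    (* [U] is the coalition just after [i] has joined [S]. *)
    rewrite (reindex_onto (fun U => U :\ i) (fun S => i |: S)) /=; last first.
      by move=> S; rewrite subsetD1 => /andP[_ iS]; rewrite setU1K.
    apply: eq_big => [U|U].
      apply/andP/andP => [[SB /eqP E]|[UB iU]].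
        rewrite -E setU11; split=> //.
        by rewrite subUset sub1set iB (subset_trans SB) // subD1set.
      by rewrite setSD // setD1K.
    move=> /andP[_ /eqP E]; rewrite E.
    by have := cardsD1 i U; rewrite -{2}E setU11 => ->.
  (* Each [U] now occurs once per member, so [set0] never does. *)
  rewrite (exchange_big_dep (fun U : {set T} => U \subset B)) /=; last first.
    by move=> i U _ /andP[].
  rewrite -g0 [in RHS](bigD1 set0) ?sub0set //= addrAC subrr add0r.
  rewrite (bigD1 set0) ?sub0set //= [X in X + _]big1 ?add0r; last first.
    by move=> i; rewrite inE !andbF.
  apply: eq_bigr => U /andP[UB U0].
  rewrite (eq_bigl [in U]) => [|i]; last first.
    rewrite UB /=.
    by case: (boolP (i \in U)) => [/(subsetP UB)->|]; rewrite ?andbF.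
  rewrite sumr_const -mulr_natl mulrA shapley_weight_pred //.
  by rewrite card_gt0 U0 subset_leq_card.
have -> : \sum_(i in B) \sum_(S : {set T} | S \subset B :\ i) w #|S| * v S
    = \sum_(U : {set T} | U \subset B) g U - v B.
  (* Each [U] occurs once per player of [B] outside it, so [B] never does. *)
  rewrite (exchange_big_dep (fun U : {set T} => U \subset B)) /=; last first.
    by move=> i U _; rewrite subsetD1 => /andP[].
  rewrite -gB [in RHS](bigD1 B) //= addrAC subrr add0r.
  rewrite (bigD1 B) //= [X in X + _]big1 ?add0r; last first.
    by move=> i; rewrite subsetD1 => /and3P[-> _].
  apply: eq_bigr => U /andP[UB UneB].
  rewrite (eq_bigl [in B :\: U]) => [|i]; last first.
    by rewrite subsetD1 UB inE andbC.
  rewrite sumr_const -mulr_natl mulrA cardsDS // shapley_weight_compl //.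
  by rewrite proper_card // properEneq UneB.
ring.
Qed.

(* For the game won by every coalition meeting [E], the value of [B \in E] sums
   over the coalitions of [P :\: E], whatever [B]; efficiency then forces
   the common value to be [#|E|^-1]. *)
Lemma shapley_winning (F : numFieldType) (T : finType) (P E : {set T}) (B : T) :
  E \subset P -> B \in E ->
  \sum_(H : {set T} | (H \subset P :\ B) && [disjoint H & E])
    shapley_weight F #|P| #|H| = #|E|%:R^-1.
Proof.
move=> EP BE.
pose x : F := \sum_(H : {set T} | H \subset P :\: E) shapley_weight F #|P| #|H|.
have avoidE D : D \in E -> forall H : {set T},
    (H \subset P :\ D) && [disjoint H & E] = (H \subset P :\: E).
  move=> DE H; rewrite subsetD1 subsetD.
  case: (boolP [disjoint H & E]) => dHE; rewrite ?andbF // !andbT.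
  by rewrite (disjointFl dHE DE) andbT.
rewrite (eq_bigl _ _ (avoidE B BE)) -/x.
(* The indicator of meeting [E] is 1 at [P] and 0 at [set0], so the Shapley values add up to 1. *)
have /= := shapley_efficiency P (fun H => (~~ [disjoint H & E])%:R : F).
rewrite -[in X in _ - X]setI_eq0 set0I eqxx subr0.
rewrite (_ : [disjoint P & E] = false) /=; last first.
  by apply/negbTE/pred0Pn; exists B; rewrite /= BE (subsetP EP).
have -> : \sum_(D in P) \sum_(H : {set T} | H \subset P :\ D)
    shapley_weight F #|P| #|H| *
      ((~~ [disjoint D |: H & E])%:R - (~~ [disjoint H & E])%:R)
  = \sum_(D in E) x.
  rewrite [RHS](big_setID P) /= (_ : E :\: P = set0) ?big_set0 ?addr0;
    last first.
    by apply/eqP; rewrite setD_eq0.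
  rewrite (setIidPl EP) [LHS](big_setID E) /= (setIidPr EP).
  (* Players outside [E] are null: joining never changes whether a coalition meets [E]. *)
  rewrite [X in _ + X]big1 ?addr0 => [|D]; last first.
    rewrite inE => /andP[DE _]; apply: big1 => H _.
    by rewrite -setI_eq0 setIUl setU_eq0 !setI_eq0 disjoints1 DE /= subrr mulr0.
  apply: eq_bigr => D DE.
  rewrite /x -(eq_bigl _ _ (avoidE D DE)) [RHS]big_mkcondr; apply: eq_bigr => H _.
  rewrite -setI_eq0 setIUl setU_eq0 !setI_eq0 disjoints1 DE /=.
  by case: [disjoint H & E]; rewrite /= ?subr0 ?subrr ?mulr1 ?mulr0.
rewrite sumr_const -[x *+ _]mulr_natl => Ex.
have E0 : #|E|%:R != 0 :> F.
  by rewrite pnatr_eq0 -lt0n card_gt0; apply/set0Pn; exists B.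
by apply: (mulfI E0); rewrite Ex divff.
Qed.

(** * Payments of unions *)

(** For fixed [H], the sum over [i] and [S] distributes the gain of the game
    [S |-> c (cover H :|: S)] on [B], and efficiency collapses it. *)
Lemma union_payment_quotient (R : realType) (N : finType) (c : {set N} -> R)
    (P : {set {set N}}) (B : {set N}) :
  trivIset P -> B \in P ->
  union_payment c P B =
    \sum_(H : {set {set N}} | H \subset P :\ B)
      shapley_weight R #|P| #|H| * (c (cover H :|: B) - c (cover H)).
Proof.
move=> tP BP; rewrite /union_payment /owen.
transitivity (\sum_(i in B) \sum_(H : {set {set N}} | H \subset P :\ B)
    shapley_weight R #|P| #|H| * \sum_(S : {set N} | S \subset B :\ i)
      shapley_weight R #|B| #|S| *
        (c (cover H :|: (i |: S)) - c (cover H :|: S))).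
  apply: eq_bigr => i iB; rewrite (def_pblock tP BP iB).
  apply: eq_bigr => H _; rewrite mulr_sumr; apply: eq_bigr => S _.
  rewrite /shapley_weight !invfM !mulrA setUA [cover H :|: S :|: _]setUAC.
  by congr (_ * _); ring.
rewrite exchange_big /=; apply: eq_bigr => H _; rewrite -mulr_sumr.
by rewrite (shapley_efficiency B (fun S => c (cover H :|: S))) setU0.
Qed.

Lemma highway_game_payment (R : realType) (N : finType) (d : Order.disp_t)
    (K : finTBOrderType d) (G : highway R N K)
    (P : {set {set N}}) (B : {set N}) :
  trivIset P -> B \in P ->
  union_payment (highway_game G) P B =
    \sum_(t | union_uses G B t)
      section_cost G t * #|[set D in P | union_uses G D t]|%:R^-1.
Proof.
move=> tP BP; rewrite union_payment_quotient //.
have usesU S S' t :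
    union_uses G (S :|: S') t = union_uses G S t || union_uses G S' t.
  by rewrite /union_uses /coalition_sections bigcup_setU inE.
have gameE S :
    highway_game G S = \sum_t section_cost G t * (union_uses G S t)%:R.
  rewrite /highway_game big_mkcond; apply: eq_bigr => t _.
  by rewrite /union_uses; case: ifP; rewrite ?mulr1 ?mulr0.
have uses_cover (H : {set {set N}}) t : H \subset P ->
    union_uses G (cover H) t =
    ~~ [disjoint H & [set D in P | union_uses G D t]].
  move=> HP; rewrite disjoint_sym; apply/idP/idP.
    case/bigcupP => i /bigcupP[D DH iD] it; apply/pred0Pn; exists D.
    rewrite /= !inE DH (subsetP HP _ DH) andbT /=.
    by apply/bigcupP; exists i.
  case/pred0Pn => D /=; rewrite !inE -andbA => /and3P[_ /bigcupP[i iD it] DH].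
  by apply/bigcupP; exists i => //; apply/bigcupP; exists D.
(* [B] adds the cost of [t] exactly when it uses [t] and no union in [H] does. *)
transitivity (\sum_(H : {set {set N}} | H \subset P :\ B)
   \sum_(t | union_uses G B t) section_cost G t * (shapley_weight R #|P| #|H| *
     [disjoint H & [set D in P | union_uses G D t]]%:R)).
  apply: eq_bigr => H HP; rewrite !gameE -sumrB mulr_sumr [RHS]big_mkcond /=.
  apply: eq_bigr => t _; rewrite usesU uses_cover; last first.
    by apply: subset_trans HP (subD1set _ _).
  by case: [disjoint _ & _]; case: (union_uses G B t) => /=; ring.
rewrite exchange_big /=; apply: eq_bigr => t Bt.
rewrite -mulr_sumr; congr (_ * _).
rewrite -(@shapley_winning _ _ P _ B) ?inE ?BP //; last first.
  by apply/subsetP => D; rewrite inE => /andP[].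
rewrite [RHS]big_mkcondr; apply: eq_bigr => H _.
by case: ifP; rewrite ?mulr1 ?mulr0.
Qed.

(* For [0 < k], the difference of the two sides is
   [c (k - 1) m / ((k + m) (m + 1))]. *)
Lemma merged_share_leif (R : realType) (c : R) (k m : nat) : 0 <= c ->
  (if (0 < k)%N then c * m.+1%:R^-1 else 0) <= c * (k%:R / (k + m)%:R)
    ?= iff [|| c == 0, (k < 2)%N | m == 0%N].
Proof.
move=> c0; case: k => [|k] /=.
  by rewrite mul0r mulr0 orbT; apply/leif_refl.
have km0 : (k.+1 + m)%:R != 0 :> R by rewrite pnatr_eq0.
have m0 : m.+1%:R != 0 :> R by rewrite pnatr_eq0.
(* After the case split [k] is the predecessor, so it stands for the factor [k - 1]. *)
have E : c * (k.+1%:R / (k.+1 + m)%:R) - c * m.+1%:R^-1 =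
    c * ((k * m)%:R / ((k.+1 + m) * m.+1)%:R).
  move: km0 m0; rewrite !natrM natrD -!natr1 => km0 m0.
  by field; rewrite m0.
split; first by rewrite -subr_ge0 E mulr_ge0 // divr_ge0.
rewrite eq_sym -subr_eq0 E !mulf_eq0 invr_eq0 !pnatr_eq0 !muln_eq0 /= orbF.
by rewrite ltnS ltnS leqn0.
Qed.

(** Strictness is characterised for positive costs, since a section of cost 0 yields no gap whoever
    uses it. *)
Theorem proposition3p2 (R : realType) (N : finType) (d : Order.disp_t)
    (K : finTBOrderType d) (G : highway R N K)
    (A : nat) (P : 'I_A -> {set N}) (a : nat)
    (P_inj : injective P) (P_part : partition (unions P) [set: N])
    (a_bounds : (2 <= a <= A)%N) :
  union_payment (highway_game G) (merged_unions P a) (alliance P a)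
    <= \sum_(b < A | (b < a)%N) union_payment (highway_game G) (unions P) (P b)
  /\ ((forall t : K, 0 < section_cost G t) ->
      (union_payment (highway_game G) (merged_unions P a) (alliance P a)
         < \sum_(b < A | (b < a)%N)
             union_payment (highway_game G) (unions P) (P b)
       <->
       exists t : K,
         (2 <= #|[set b : 'I_A | (b < a)%N && union_uses G (P b) t]|)%N
         /\ (exists b : 'I_A, (a <= b)%N /\ union_uses G (P b) t))).
Proof.
have [_ /trivIsetP tP P0] := and3P P_part.
have unions_P b : P b \in unions P by apply: imset_f.
have same b b' i : i \in P b -> i \in P b' -> b = b'.
  move=> ib ib'; apply/eqP; apply: contraLR ib' => bb'.
  have /disjointFr-> // : [disjoint P b & P b'].
  by apply: tP => //; rewrite (inj_eq P_inj).
have in_alliance i :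
    i \in alliance P a -> exists2 b : 'I_A, (b < a)%N & i \in P b.
  by case/bigcupP => b; exists b.
have alliance_disj (b : 'I_A) : (a <= b)%N -> [disjoint alliance P a & P b].
  move=> ab; apply/pred0P => i /=; apply/negP.
  case/andP=> /in_alliance[b' b'a ib'] ib.
  by move: b'a; rewrite (same _ _ _ ib' ib) ltnNge ab.
have tM : trivIset (merged_unions P a).
  apply/trivIsetP => D D'; rewrite !inE.
  case/orP=> [/eqP->|/imsetP[b ab ->]]; case/orP=> [/eqP->|/imsetP[b' ab' ->]];
    rewrite ?eqxx // => DD'.
  - by apply: alliance_disj; rewrite inE in ab'.
  - by rewrite disjoint_sym; apply: alliance_disj; rewrite inE in ab.
  - exact: tP.
(* Otherwise [P b] would be disjoint from itself, hence an empty union. *)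
have allianceNP (b : 'I_A) : (a <= b)%N -> alliance P a != P b.
  move=> ab; apply: contraNneq P0 => E.
  have := alliance_disj b ab; rewrite E -setI_eq0 setIid => /eqP <-.
  exact: unions_P.
pose k t := #|[set b : 'I_A | (b < a)%N && union_uses G (P b) t]|.
pose m t := #|[set b : 'I_A | (a <= b)%N && union_uses G (P b) t]|.
(* Injectivity of [P] turns the count of unions as sets into a count of indices. *)
have usersP t : #|[set D in unions P | union_uses G D t]| = (k t + m t)%N.
  rewrite (_ : [set D in _ | _] = P @: [set b | union_uses G (P b) t]);
    last first.
    apply/setP => D; rewrite inE.
    apply/andP/imsetP => [[/imsetP[b _ ->] Dt]|[b]].
      by exists b; rewrite ?inE.
    by rewrite inE => bt ->.
  rewrite card_imset // -(cardsID [set b : 'I_A | (b < a)%N]) /k /m.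
  set X := _ :&: _; set Y := _ :\: _.
  have -> : X = [set b : 'I_A | (b < a)%N && union_uses G (P b) t].
    by apply/setP => b; rewrite !inE andbC.
  have -> // : Y = [set b : 'I_A | (a <= b)%N && union_uses G (P b) t].
  by apply/setP => b; rewrite !inE -leqNgt.
have uses_alliance t : union_uses G (alliance P a) t = (0 < k t)%N.
  rewrite card_gt0; apply/idP/set0Pn => [|[b]].
    case/bigcupP => i /in_alliance[b ba ib] it.
    by exists b; rewrite inE ba /=; apply/bigcupP; exists i.
  rewrite inE => /andP[ba /bigcupP[i ib it]]; apply/bigcupP; exists i => //.
  by apply/bigcupP; exists b.
(* The successor accounts for the alliance itself, which by [allianceNP] is none of the outside
   unions. *)
have usersM t : (0 < k t)%N ->
    #|[set D in merged_unions P a | union_uses G D t]| = (m t).+1.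
  rewrite -uses_alliance => at_.
  rewrite (_ : [set D in _ | _] =
      alliance P a |: P @: [set b : 'I_A | (a <= b)%N && union_uses G (P b) t]).
    rewrite cardsU1 card_imset // (_ : _ \notin _) //.
    apply/imsetP => -[b]; rewrite inE => /andP[ab _].
    exact/eqP/allianceNP.
  apply/setP => D; rewrite !inE; apply/andP/orP.
    case=> /orP[->|/imsetP[b ab ->] bt]; [by left|right].
    by apply: imset_f; rewrite !inE in ab *; rewrite ab.
  case=> [/eqP->|/imsetP[b]]; first by rewrite eqxx.
  rewrite inE => /andP[ab bt] ->; split=> //; apply/orP; right.
  by apply: imset_f; rewrite inE.
have -> : union_payment (highway_game G) (merged_unions P a) (alliance P a) =
    \sum_t (if (0 < k t)%N then section_cost G t * (m t).+1%:R^-1 else 0).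
  rewrite highway_game_payment // ?setU11 // big_mkcond; apply: eq_bigr => t _.
  by rewrite uses_alliance; case: ifP => // /usersM->.
have -> : \sum_(b < A | (b < a)%N)
    union_payment (highway_game G) (unions P) (P b)
    = \sum_t section_cost G t * ((k t)%:R / (k t + m t)%:R).
  transitivity (\sum_(b < A | (b < a)%N) \sum_(t | union_uses G (P b) t)
      section_cost G t / (k t + m t)%:R).
    apply: eq_bigr => b _.
    rewrite highway_game_payment //; last exact/trivIsetP.
    by apply: eq_bigr => t _; rewrite usersP.
  (* Section [t] is charged once to each of the [k t] alliance members using it. *)
  rewrite (exchange_big_dep predT) //=; apply: eq_bigr => t _.
  rewrite (eq_bigl [in [set b : 'I_A | (b < a)%N && union_uses G (P b) t]]).
    by rewrite sumr_const -[LHS]mulr_natl mulrCA.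
  by move=> b; rewrite inE.
(* Summing keeps the equality case: the totals agree iff the shares agree for every section. *)
have leifS := leif_sum (fun t (_ : true) =>
  merged_share_leif (k t) (m t) (section_cost_ge0 G t)).
split=> [|cost_gt0]; first exact: (leif_le leifS).
rewrite (lt_leif leifS); split.
  rewrite negb_forall => /existsP[t]; rewrite /= !negb_or -leqNgt -lt0n.
  case/and3P=> _ kt; rewrite card_gt0 => /set0Pn[b].
  rewrite inE => /andP[ab bt].
  by exists t; split=> //; exists b.
case=> t [kt [b [ab bt]]]; rewrite negb_forall; apply/existsP; exists t.
(* Positivity of the cost excludes the equality case [c == 0]. *)
rewrite /= !negb_or -leqNgt kt gt_eqF //= -lt0n card_gt0.
by apply/set0Pn; exists b; rewrite inE ab.
Qed.
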